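(* Let $S_0(x,y)=y^2+(x^2+1)y+x^3$ and for $\theta\in[0,\pi]$ let $y_-(e^{i\theta}),y_+(e^{i\theta})$ be the two roots of $S_0(e^{i\theta},y)=0$ in $y$, labelled so that $|y_-|\le|y_+|$. Then for all $\theta\in[0,\pi]$ $$|y_-(e^{i\theta})|\le 1\le |y_+(e^{i\theta})|,$$ and $|y_-(e^{i\theta})|$ attains its maximum value $1$ only at $\theta=0$ and $\theta=\pi/2$. Since $|y_+y_-|=|x^3|=1$ on the torus, $$m(S_0)=\frac1\pi\int_0^\pi\log|y_+(e^{i\theta})|\,d\theta=-\frac1\pi\int_0^\pi\log|y_-(e^{i\theta})|\,d\theta=-(I_1+I_2),$$ where $I_1=\frac1\pi\int_0^{\pi/2}\log|y_-(e^{i\theta})|\,d\theta$ and $I_2=\frac1\pi\int_{\pi/2}^{\pi}\log|y_-(e^{i\theta})|\,d\theta$.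
   Context: $m(P)=\int_0^1\int_0^1\log|P(e^{2\pi i t_1},e^{2\pi i t_2})|\,dt_1\,dt_2$ is the logarithmic Mahler measure of a nonzero two-variable Laurent polynomial $P$. *)

(* Defs.v *)
From HB Require Import structures.
From mathcomp Require Import all_boot all_order all_algebra.
From mathcomp Require Import polyXY.
From mathcomp Require Import complex.
From mathcomp Require Import all_classical all_reals all_analysis.

Set Implicit Arguments.
Unset Strict Implicit.
Unset Printing Implicit Defensive.

Import Order.TTheory GRing.Theory Num.Theory.
Import numFieldNormedType.Exports.

Local Open Scope classical_set_scope.
Local Open Scope ring_scope.
Local Open Scope complex_scope.

(* The norm of R[i] takes its values in R[i]; this is the real-valued modulus. *)
Notation cmod := Normc.normc (only parsing).

Definition expi (R : realType) (theta : R) : R[i] := cos theta +i* sin theta.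

(* A Laurent polynomial enters through the function it induces on the torus.
   The integral is over [0,1]^2 for the product Lebesgue measure, and
   lne 0 = -oo, so that no value is chosen by convention at the zeros of P. *)
Definition mahler_measure (R : realType) (P : R[i] -> R[i] -> R[i]) : \bar R :=
  (\int[lebesgue_measure \x lebesgue_measure]_(t in `[0%R, 1%R] `*` `[0%R, 1%R])
     lne (cmod (P (expi (2 * pi * t.1)%R) (expi (2 * pi * t.2)%R)))%:E)%E.

(* In {poly {poly _}}, 'X is the outer variable and 'Y the inner one, so that
   S0.[a%:P] is the univariate polynomial S_0(a, y) in y. *)
Definition S0 (R : realType) : {poly {poly R[i]}} :=
  'Y ^+ 2 + ('X ^+ 2 + 1) * 'Y + 'X ^+ 3.

(* Main.v *)
Require Import Defs.
From HB Require Import structures.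
From mathcomp Require Import all_boot all_order all_algebra.
From mathcomp Require Import polyXY.
From mathcomp Require Import complex.
From mathcomp Require Import all_classical all_reals all_analysis.
From mathcomp Require Import measurable_realfun lebesgue_integral_fubini.
From mathcomp Require Import ring lra.

(** Write [x = e^(i theta)] and [u = cos theta].  Since [x^2 + 1 = 2 u x], the
    two roots [a], [b] of [S0 (x, y)] in [y] satisfy [|a + b| = 2 |u|],
    [|a b| = 1] and [(a - b)^2 = 4 x^2 (u^2 - x)], so the parallelogram law
    gives
      [|a|^2 + |b|^2 = 2 (u^2 + sqrt (u^4 - 2 u^3 + 1))]
    ([moduli_sqr_sumE]).  The moduli of the roots are thereby explicit
    continuous functions of [u].  The right-hand side is at least 2 because
    [u^4 - 2 u^3 + 1 - (1 - u^2)^2 = 2 u^2 (1 - u)], with equality exactly for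
    [u = 0] and [u = 1]; as [|a| |b| = 1], this says that a root lies on the
    unit circle exactly for these two values of [u], that is, for
    [theta = pi / 2] and [theta = 0] in [[0, pi]].

    For the Mahler measure, the inner integral is evaluated by Jensen's formula
    for the two linear factors ([Jensen_inside], [Jensen_outside]), outside the
    finite set of [x] above which the roots lie on the unit circle.  There the
    integrand is continuous, and Jensen's formula follows from the identity
    [(e - a)(- e - a) = - (e^2 - a^2)]: the integral [F a] of [ln |e - a|] over
    the circle satisfies [2 F a = F (a^2)], so for [|a| < 1] the numbers
    [2^n F a] are bounded and [F a = 0]; for [|a| > 1] one uses
    [|e - a| = |a| |e - 1 / conj a|].

    The logarithm is [-oo] at the zeros of [S0] on the torus, so integrability
    is not known in advance.  It comes from Tonelli's theorem applied to the
    nonnegative function [ln 4 - ln |S0|] ([integral_defect]); the bound 4 is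
    the number of monomials of [S0].  The outer integral over the circle is
    folded onto [[0, pi]] since the integrand depends on [cos theta] only. *)

Set Implicit Arguments.
Unset Strict Implicit.
Unset Printing Implicit Defensive.

Import Order.TTheory GRing.Theory Num.Theory.
Import numFieldNormedType.Exports.

Local Open Scope classical_set_scope.
Local Open Scope ring_scope.
Local Open Scope complex_scope.

(** * Moduli of complex numbers *)

Lemma normc_sqr (R : realType) (z : R[i]) :
  cmod z ^+ 2 = complex.Re z ^+ 2 + complex.Im z ^+ 2.
Proof. by case: z => a b /=; rewrite sqr_sqrtr// addr_ge0// sqr_ge0. Qed.

Lemma normc_ge0 (R : realType) (z : R[i]) : 0 <= cmod z.
Proof. by case: z => a b; exact: sqrtr_ge0. Qed.

Lemma normc_expi (R : realType) (theta : R) : cmod (expi theta) = 1.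
Proof. by rewrite /expi /= cos2Dsin2 sqrtr1. Qed.

Lemma normcX (R : realType) (z : R[i]) n : cmod (z ^+ n) = cmod z ^+ n.
Proof.
by elim: n => [|n IH]; rewrite ?expr0 ?Normc.normc1// !exprS Normc.normcM IH.
Qed.

Lemma normc_expiX (R : realType) (theta : R) n : cmod (expi theta ^+ n) = 1.
Proof. by rewrite normcX normc_expi expr1n. Qed.

(** * The roots of S0 above a point of the unit circle *)

Lemma S0E (R : realType) (x y : R[i]) :
  (S0 R).[x, y] = y ^+ 2 + (x ^+ 2 + 1) * y + x ^+ 3.
Proof. by rewrite /S0 !hornerE. Qed.

(** Vieta's relations carry all that is used about the two roots, multiplicity
    included. *)
Lemma Vieta_S0 (R : realType) (x a b : R[i]) :
  (S0 R).[x%:P] = ('X - a%:P) * ('X - b%:P) ->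
  a + b = - (x ^+ 2 + 1) /\ a * b = x ^+ 3.
Proof.
move=> H.
have e y : y ^+ 2 + (x ^+ 2 + 1) * y + x ^+ 3 = (y - a) * (y - b).
  by rewrite -S0E H !hornerE.
have ab : a * b = x ^+ 3.
  by transitivity ((0 - a) * (0 - b)); [ring|rewrite -e; ring].
split=> //; transitivity (1 + a * b - (1 - a) * (1 - b)); first by ring.
by rewrite -e ab; ring.
Qed.

Lemma S0_has_roots (R : realType) (x : R[i]) :
  exists a b : R[i], [/\ a + b = - (x ^+ 2 + 1), a * b = x ^+ 3 & cmod a <= cmod b].
Proof.
pose d := sqrtc ((x ^+ 2 + 1) ^+ 2 - 4 * x ^+ 3).
have dd : d ^+ 2 = (x ^+ 2 + 1) ^+ 2 - 4 * x ^+ 3 by rewrite sqr_sqrtc.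
pose a := (- (x ^+ 2 + 1) + d) / 2; pose b := (- (x ^+ 2 + 1) - d) / 2.
have ab1 : a + b = - (x ^+ 2 + 1) by rewrite /a /b; field.
have ab2 : a * b = x ^+ 3.
  rewrite /a /b.
  transitivity (((x ^+ 2 + 1) ^+ 2 - d ^+ 2) / 4); first by field.
  by rewrite dd; field.
have [ab|ba] := leP (cmod a) (cmod b); first by exists a, b.
by exists b, a; split; rewrite ?(ltW ba)// 1?addrC 1?mulrC.
Qed.

Section RootModuli.
Context {R : realType}.
Implicit Types (u theta : R).

(** The sum of the squared moduli of the two roots above [e^(i theta)], in terms
    of [u = cos theta]. *)
Definition moduli_sqr_sum u := 2 * (u ^+ 2 + Num.sqrt (u ^+ 4 - 2 * u ^+ 3 + 1)).

(** The squared modulus [p] of the larger root solves [p + 1 / p = s] with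
    [s = moduli_sqr_sum u]; this is the solution that is at least 1. *)
Definition outer_modulus u :=
  Num.sqrt ((moduli_sqr_sum u + Num.sqrt (moduli_sqr_sum u ^+ 2 - 4)) / 2).

Lemma parallelogram (a b : R[i]) :
  cmod a ^+ 2 + cmod b ^+ 2 = (cmod (a + b) ^+ 2 + cmod (a - b) ^+ 2) / 2.
Proof. by rewrite !normc_sqr; case: a => ? ?; case: b => ? ? /=; field. Qed.

(** By the parallelogram law only [a + b] and the discriminant [(a - b)^2]
    matter.  On the circle [x^2 + 1 = 2 u x], so the discriminant
    [(x^2 + 1)^2 - 4 x^3] is [4 x^2 (u^2 - x)], whose modulus is explicit. *)
Lemma moduli_sqr_sumE theta (a b : R[i]) :
  a + b = - (expi theta ^+ 2 + 1) -> a * b = expi theta ^+ 3 ->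
  cmod a ^+ 2 + cmod b ^+ 2 = moduli_sqr_sum (cos theta).
Proof.
move=> ab1 ab2; set x := expi theta; set u := cos theta.
have x21 : x ^+ 2 + 1 = (2 * u)%:C * x.
  rewrite /x /expi -/u expr2; apply/eqP; rewrite eq_complex /=; apply/andP; split; apply/eqP.
    have := cos2Dsin2 theta; rewrite -/u => /(canRL (addKr _)) ss.
    by rewrite -(expr2 (sin _)) ss; ring.
  by rewrite -/u; ring.
have disc : (a - b) ^+ 2 = 4 * x ^+ 2 * ((u ^+ 2)%:C - x).
  transitivity ((a + b) ^+ 2 - 4 * (a * b)); first by ring.
  by rewrite ab1 ab2 -/x x21; ring.
have ux : cmod ((u ^+ 2)%:C - x) ^+ 2 = u ^+ 4 - 2 * u ^+ 3 + 1.
  rewrite normc_sqr /x /expi /= -/u.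
  have := cos2Dsin2 theta; rewrite -/u => /(canRL (addKr _)) ss.
  by rewrite add0r sqrrN ss; ring.
have n4 : cmod (4 : R[i]) = 4.
  by rewrite -[4 in LHS](rmorph_nat (@real_complex R)) /= expr0n addr0 sqrtr_sqr ger0_norm.
rewrite parallelogram ab1 -/x x21 /moduli_sqr_sum -ux sqrtr_sqr ger0_norm ?normc_ge0//.
have -> : cmod (a - b) ^+ 2 = 4 * cmod ((u ^+ 2)%:C - x).
  by rewrite -[cmod _ ^+ 2]Normc.normcM -expr2 disc !Normc.normcM normc_expi !mulr1 n4.
rewrite normcN Normc.normcM normc_expi mulr1 normc_sqr /= expr0n addr0; by field.
Qed.

Lemma radicand_ge (u : R) : u <= 1 ->
  (1 - u ^+ 2) ^+ 2 <= u ^+ 4 - 2 * u ^+ 3 + 1.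
Proof.
move=> u1; rewrite -subr_ge0.
have -> : u ^+ 4 - 2 * u ^+ 3 + 1 - (1 - u ^+ 2) ^+ 2 = 2 * u ^+ 2 * (1 - u) by ring.
by rewrite mulr_ge0 ?subr_ge0// mulr_ge0 ?sqr_ge0 ?ler0n.
Qed.

Lemma moduli_sqr_sum_ge2 u : u <= 1 -> 2 <= moduli_sqr_sum u.
Proof.
move=> u1; have := ler_wsqrtr (radicand_ge u1); rewrite sqrtr_sqr.
have := ler_norm (1 - u ^+ 2); rewrite /moduli_sqr_sum.
by set w := Num.sqrt _; lra.
Qed.

Lemma moduli_sqr_sum_eq2 u : -1 <= u <= 1 ->
  moduli_sqr_sum u = 2 -> u = 0 \/ u = 1.
Proof.
move=> /andP[u0 u1] H.
have ss : Num.sqrt (u ^+ 4 - 2 * u ^+ 3 + 1) = 1 - u ^+ 2.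
  by move: H; rewrite /moduli_sqr_sum => H; lra.
have := congr1 (fun z => z ^+ 2) ss; rewrite sqr_sqrtr; last first.
  exact: le_trans (sqr_ge0 _) (radicand_ge u1).
move=> e; have : u ^+ 2 * (1 - u) = 0 by lra.
move=> /eqP; rewrite mulf_eq0 expf_eq0 /= subr_eq0 => /orP[/eqP->|/eqP<-]; by [left|right].
Qed.

Lemma moduli_sqr_sum0 : moduli_sqr_sum 0 = 2.
Proof. by rewrite /moduli_sqr_sum !expr0n /= mulr0 subr0 !add0r sqrtr1 mulr1. Qed.

Lemma moduli_sqr_sum1 : moduli_sqr_sum 1 = 2.
Proof.
rewrite /moduli_sqr_sum !expr1n mulr1.
by rewrite (_ : 1 - 2 + 1 = 0 :> R) ?sqrtr0 ?addr0 ?mulr1//; ring.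
Qed.

Lemma outer_modulus_ge1 u : u <= 1 -> 1 <= outer_modulus u.
Proof.
move=> /moduli_sqr_sum_ge2 s2; rewrite -[leLHS]sqrtr1 /outer_modulus ler_sqrt.
  by have := sqrtr_ge0 (moduli_sqr_sum u ^+ 2 - 4); lra.
by have := sqrtr_ge0 (moduli_sqr_sum u ^+ 2 - 4); lra.
Qed.

(** The product of the moduli being 1, [s^2 - 4] is the square of
    [|b|^2 - |a|^2]. *)
Lemma larger_modulusE theta (a b : R[i]) :
  a + b = - (expi theta ^+ 2 + 1) -> a * b = expi theta ^+ 3 ->
  cmod a <= cmod b -> cmod b = outer_modulus (cos theta).
Proof.
move=> ab1 ab2 ab; have s := moduli_sqr_sumE ab1 ab2.
have p : cmod a * cmod b = 1 by rewrite -Normc.normcM ab2 normc_expiX.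
have a0 := normc_ge0 a; have b0 := normc_ge0 b.
rewrite /outer_modulus -s.
have -> : (cmod a ^+ 2 + cmod b ^+ 2) ^+ 2 - 4 = (cmod b ^+ 2 - cmod a ^+ 2) ^+ 2.
  transitivity ((cmod b ^+ 2 - cmod a ^+ 2) ^+ 2 + 4 * (cmod a * cmod b) ^+ 2 - 4); first by ring.
  by rewrite p; ring.
rewrite sqrtr_sqr ger0_norm ?subr_ge0 ?ler_sqr//.
rewrite (_ : _ / 2 = cmod b ^+ 2); last by field.
by rewrite sqrtr_sqr ger0_norm.
Qed.

(** Moduli with product 1 are both 1 exactly when their squares add up to 2. *)
Lemma modulus_eq1 theta (a b : R[i]) :
  a + b = - (expi theta ^+ 2 + 1) -> a * b = expi theta ^+ 3 ->
  cmod a = 1 <-> cos theta = 0 \/ cos theta = 1.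
Proof.
move=> ab1 ab2; have s := moduli_sqr_sumE ab1 ab2.
have p : cmod a * cmod b = 1 by rewrite -Normc.normcM ab2 normc_expiX.
split=> [a1|H].
  apply: moduli_sqr_sum_eq2; first by rewrite cos_geN1 cos_le1.
  by move: p; rewrite -s a1 mul1r => ->; rewrite expr1n; ring.
have {}s : cmod a ^+ 2 + cmod b ^+ 2 = 2.
  by rewrite s; case: H => ->; rewrite (moduli_sqr_sum0, moduli_sqr_sum1).
have ab : cmod a = cmod b.
  apply/eqP; rewrite -subr_eq0 -sqrf_eq0; apply/eqP.
  by transitivity (cmod a ^+ 2 + cmod b ^+ 2 - 2 * (cmod a * cmod b));
    [ring|rewrite s p; ring].
by apply/eqP; rewrite -(@eqrXn2 _ 2) ?normc_ge0// expr2 {2}ab p expr1n.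
Qed.

End RootModuli.

(** * Integrals of continuous functions on segments *)

Section ContinuousIntegrals.
Context {R : realType}.
Notation mu := (@lebesgue_measure R).
Implicit Types (f g : R -> R) (a b c k : R).

Lemma continuous_integrable_itv f a b :
  continuous f -> mu.-integrable `[a, b] (EFin \o f).
Proof.
move=> cf; apply: continuous_compact_integrable; first exact: segment_compact.
exact: continuous_subspaceT.
Qed.

Lemma integral_EFin_continuous (f : R -> R) (a b : R) : continuous f ->
  (\int[mu]_(x in `[a, b]) (f x)%:E)%E = (\int[mu]_(x in `[a, b]) f x)%:E.
Proof.
move=> cf; rewrite fineK//; apply: integrable_fin_num => //.
exact: (continuous_integrable_itv _ _ cf).
Qed.

Lemma Rintegral_itv_split f a c b : continuous f -> a <= c <= b ->
  \int[mu]_(x in `[a, b]) f x =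
  \int[mu]_(x in `[a, c]) f x + \int[mu]_(x in `[c, b]) f x.
Proof.
move=> cf /andP[ac cb].
have := @Rintegral_itvB R f (BLeft a) (BRight b) c (continuous_integrable_itv _ _ cf).
rewrite !bnd_simp => /(_ ac cb) H.
rewrite -(Rintegral_itv_obnd_cbnd (r := c)); first by rewrite -H; ring.
apply: integrableS (continuous_integrable_itv a b cf) => //.
by apply: subset_itv; rewrite bnd_simp.
Qed.

Lemma Rintegral_affine f a b k c : continuous f -> 0 < k -> a <= b ->
  \int[mu]_(x in `[k * a + c, k * b + c]) f x =
  k * \int[mu]_(x in `[a, b]) f (k * x + c).
Proof.
move=> cf k0 ab; pose F x := k * x + c.
have dF x : is_derive x (1 : R) F k.
  apply: is_derive_eq; rewrite /GRing.scale /=; ring.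
have dF1 : derive1 F = cst k by apply/funext => x; rewrite derive1E derive_val.
have cF : continuous F.
  move=> x; apply: cvgD; last exact: cvg_cst.
  by apply: cvgM; [exact: cvg_cst|exact: cvg_id].
have cfF : continuous (f \o F).
  by move=> x; apply: continuous_comp; [exact: cF|exact: cf].
rewrite -RintegralZl//; last exact: (continuous_integrable_itv _ _ cfF).
congr fine; rewrite -/(F a) -/(F b) integration_by_substitution_increasing //.
- by apply: eq_integral => x _; rewrite dF1 /= mulrC.
- by move=> x y _ _ xy; rewrite /F ltrD2r ltr_pM2l.
- by rewrite dF1 => x _; exact: cvg_cst.
- by rewrite dF1; exact: is_cvg_cst.
- by rewrite dF1; exact: is_cvg_cst.
- split; first by move=> x _; exact: ex_derive.
  + by apply: cvg_at_right_filter; exact: cF.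
  + by apply: cvg_at_left_filter; exact: cF.
- exact: continuous_subspaceT.
Qed.

Lemma Rintegral_even f a : continuous f -> 0 <= a -> (forall x, f (- x) = f x) ->
  \int[mu]_(x in `[- a, 0]) f x = \int[mu]_(x in `[0, a]) f x.
Proof.
move=> cf a0 ev; have := @integration_by_substitution_oppr R f 0 a a0.
rewrite oppr0 => H; rewrite /Rintegral H; last exact: continuous_subspaceT.
by congr fine; apply: eq_integral => x _; rewrite /= ev.
Qed.

Lemma Rintegral_cst_itv a b k : a <= b -> \int[mu]_(x in `[a, b]) k = k * (b - a).
Proof.
move=> ab; rewrite Rintegral_cst//= lebesgue_measure_itv /= lte_fin.
by case: ltP => //; rewrite le_eqVlt ltNge ab orbF => /eqP ->; rewrite subrr.
Qed.

Lemma ler_norm_Rintegral_itv f a b M : continuous f -> a <= b ->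
  (forall x, `|f x| <= M) -> `|\int[mu]_(x in `[a, b]) f x| <= M * (b - a).
Proof.
move=> cf ab fM; apply: le_trans (le_normr_Rintegral _ _) _ => //.
  exact: continuous_integrable_itv.
rewrite -(Rintegral_cst_itv M ab); apply: le_Rintegral => //.
- have cnf : continuous (fun x => `|f x|).
    by move=> x; apply: continuous_comp; [exact: cf|exact: norm_continuous].
  exact: (continuous_integrable_itv _ _ cnf).
- by apply: (@continuous_integrable_itv (fun=> M)) => x; exact: cvg_cst.
Qed.

End ContinuousIntegrals.

(** * Jensen's formula for a linear factor *)

Section Jensen.
Context {R : realType}.
Notation mu := (@lebesgue_measure R).
Implicit Types (a : R[i]) (t theta : R).

Lemma expiDpi theta : expi (theta + pi) = - expi theta.
Proof. by rewrite /expi cosDpi sinDpi. Qed.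

Lemma expi_double theta : expi (2 * theta) = expi theta ^+ 2.
Proof.
rewrite /expi mulr_natl cos_mulr2n sin_mulr2n expr2; apply/eqP.
rewrite eq_complex /=; apply/andP; split; apply/eqP; last by ring.
by have /(canRL (addKr _)) ss := cos2Dsin2 theta; rewrite -(expr2 (sin _)) ss; ring.
Qed.

Definition log_dist a t := ln (cmod (expi (2 * pi * t) - a)).

Lemma le_normcB (z w : R[i]) : cmod z - cmod w <= cmod (z - w).
Proof. by rewrite lerBlDr -[z in leLHS](subrK w) le_normcD. Qed.

Lemma expi_dist_bounds theta a :
  1 - cmod a <= cmod (expi theta - a) <= 1 + cmod a.
Proof.
rewrite -(normc_expi theta) le_normcB /=.
by rewrite -[cmod a]normcN le_normcD.
Qed.

Lemma expi_dist_gt0 theta a : cmod a != 1 -> 0 < cmod (expi theta - a).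
Proof.
move=> a1; rewrite lt_neqAle normc_ge0 andbT eq_sym.
apply: contra a1 => /eqP /Normc.eq0_normc /eqP; rewrite subr_eq0 => /eqP <-.
by rewrite normc_expi.
Qed.

Lemma continuous_comp_cos (k : R) : continuous (fun t => cos (k * t)).
Proof.
move=> t; apply: (continuous_comp (f := fun t => k * t)); last exact: continuous_cos.
by apply: cvgM; [exact: cvg_cst|exact: cvg_id].
Qed.

Lemma continuous_comp_sin (k : R) : continuous (fun t => sin (k * t)).
Proof.
move=> t; apply: (continuous_comp (f := fun t => k * t)); last exact: continuous_sin.
by apply: cvgM; [exact: cvg_cst|exact: cvg_id].
Qed.

Lemma continuous_expi_dist a : continuous (fun t => cmod (expi (2 * pi * t) - a)).
Proof.
case: a => a1 a2 t; rewrite /expi /=.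
apply: (continuous_comp (f := fun t : R =>
  (cos (2 * pi * t) - a1) ^+ 2 + (sin (2 * pi * t) - a2) ^+ 2)).
  have csqr (f : R -> R) c : continuous f -> {for t, continuous (fun t => (f t - c) ^+ 2)}.
    move=> cf.
    apply: (continuous_comp (f := fun t => f t - c) (g := fun x : R => x ^+ 2));
      last exact: exprn_continuous.
    by apply: cvgB; [exact: cf|exact: cvg_cst].
  apply: cvgD; apply: csqr; by [exact: continuous_comp_cos|exact: continuous_comp_sin].
exact: sqrt_continuous.
Qed.

Lemma continuous_log_dist a : cmod a != 1 -> continuous (log_dist a).
Proof.
move=> a1 t; apply: (continuous_comp (f := fun t => cmod (expi (2 * pi * t) - a))).
  exact: continuous_expi_dist.
by apply: continuous_ln; exact: expi_dist_gt0.
Qed.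

(** Half a period apart the points of the circle are opposite, and
    [(e - a)(- e - a) = - (e^2 - a^2)], where [e^2] runs at double speed.  The
    arguments are left in the form [k * t + c] for [Rintegral_affine]. *)
Lemma log_dist_half_period a t : cmod a != 1 ->
  log_dist a t + log_dist a (1 * t + 1 / 2) = log_dist (a ^+ 2) (2 * t + 0).
Proof.
move=> a1; rewrite /log_dist -lnM ?posrE ?expi_dist_gt0//.
rewrite -Normc.normcM -[RHS](congr1 (@ln R) (normcN _)); congr (ln (cmod _)).
have -> : 2 * pi * (1 * t + 1 / 2) = 2 * pi * t + pi :> R by field.
have -> : 2 * pi * (2 * t + 0) = 2 * (2 * pi * t) :> R by ring.
by rewrite expiDpi expi_double; ring.
Qed.

(** Folding the period in two turns the sum over opposite points into the
    function attached to [a ^+ 2], run through once. *)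
Lemma integral_log_dist_sqr a : cmod a != 1 ->
  2 * \int[mu]_(t in `[0, 1]) log_dist a t =
  \int[mu]_(t in `[0, 1]) log_dist (a ^+ 2) t.
Proof.
move=> a1; have ca := continuous_log_dist a1.
have a21 : cmod (a ^+ 2) != 1 by rewrite normcX sqrp_eq1 ?normc_ge0.
have ca2 := continuous_log_dist a21.
have half01 : 0 <= (1 / 2 : R) <= 1 by apply/andP; split; lra.
have cshift : continuous (fun t : R => log_dist a (1 * t + 1 / 2)).
  move=> t; apply: (continuous_comp (f := fun t : R => 1 * t + 1 / 2)); last exact: ca.
  apply: cvgD; last exact: cvg_cst.
  by apply: cvgM; [exact: cvg_cst|exact: cvg_id].
rewrite (Rintegral_itv_split ca half01).
have e0 : \int[mu]_(t in `[1 / 2, 1]) log_dist a t =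
    \int[mu]_(t in `[0, 1 / 2]) log_dist a (1 * t + 1 / 2).
  rewrite -[RHS]mul1r -(Rintegral_affine _ ca ltr01); last by lra.
  by rewrite mulr0 add0r (_ : 1 * (1 / 2) + 1 / 2 = 1)//; field.
rewrite e0 -RintegralD//; [|exact: continuous_integrable_itv..].
under eq_Rintegral do rewrite log_dist_half_period//.
rewrite -(Rintegral_affine _ ca2); [|lra..].
by rewrite !addr0 mulr0 (_ : 2 * (1 / 2) = 1)//; field.
Qed.

(** Iterating [integral_log_dist_sqr] multiplies the integral by [2 ^+ n] while
    replacing [a] with [a ^+ (2 ^ n)], whose modulus does not exceed [cmod a];
    the integral stays bounded, so it vanishes. *)
Lemma Jensen_inside a : cmod a < 1 ->
  \int[mu]_(t in `[0, 1]) log_dist a t = 0.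
Proof.
move=> a1.
have powlt n : cmod (a ^+ n.+1) <= cmod a.
  by rewrite normcX exprS ler_piMr ?normc_ge0// exprn_ile1 ?normc_ge0// ltW.
have pow2lt n : cmod (a ^+ (2 ^ n)) <= cmod a.
  by case: (2 ^ n)%N (expn_gt0 2 n) => // k _; exact: powlt.
have iter n : 2 ^+ n * \int[mu]_(t in `[0, 1]) log_dist a t =
    \int[mu]_(t in `[0, 1]) log_dist (a ^+ (2 ^ n)) t.
  elim: n => [|n IH]; first by rewrite expr0 mul1r expn0 expr1.
  rewrite exprS -mulrA IH integral_log_dist_sqr ?lt_eqF ?(le_lt_trans (pow2lt n))//.
  by rewrite -exprM mulnC -expnS.
set F := \int[mu]_(t in _) _ in iter *.
pose C := - ln (1 - cmod a).
have bnd n t : `|log_dist (a ^+ (2 ^ n)) t| <= C.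
  set b := a ^+ _; have ba : cmod b <= cmod a := pow2lt n.
  have b1 : cmod b != 1 by rewrite lt_eqF// (le_lt_trans ba).
  have /andP[lo hi] := expi_dist_bounds (2 * pi * t) b.
  have p := expi_dist_gt0 (2 * pi * t) b1.
  rewrite ler_norml /C opprK /log_dist; apply/andP; split.
    by rewrite ler_ln ?posrE ?subr_gt0//; lra.
  (* 1 + |a| <= 1 / (1 - |a|), so that one constant serves both bounds *)
  rewrite -lnV ?posrE ?subr_gt0// ler_ln ?posrE ?invr_gt0 ?subr_gt0//.
  apply: le_trans hi _; rewrite -[leRHS]mul1r ler_pdivlMr ?subr_gt0//.
  have := normc_ge0 a; nra.
have small n : 2 ^+ n * `|F| <= C.
  rewrite -[X in X * _](@ger0_norm _ (2 ^+ n)) ?exprn_ge0// -normrM iter.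
  have b1 : cmod (a ^+ (2 ^ n)) != 1 by rewrite lt_eqF// (le_lt_trans (pow2lt n)).
  have := ler_norm_Rintegral_itv (continuous_log_dist b1) (@ler01 R) (bnd n).
  by rewrite subr0 mulr1.
(* 2 ^+ n > n eventually exceeds C / |F| *)
apply/eqP/negPn/negP => F0; have F1 : 0 < `|F| by rewrite normr_gt0.
have C0 : 0 <= C / `|F|.
  by rewrite divr_ge0// (le_trans _ (small 0%N))// expr0 mul1r.
have := archi_boundP C0; set n := Num.bound _.
rewrite ltr_pdivrMr// => /(le_lt_trans (small n)).
rewrite ltr_pM2r// -natrX ltr_nat ltnNge => /negP; apply.
exact/ltnW/ltn_expl.
Qed.

(** Inversion in the unit circle, [|e - a| = |a| |e - 1 / conj a|] for
    [|e| = 1], reduces this to [Jensen_inside]. *)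
Lemma Jensen_outside a : 1 < cmod a ->
  \int[mu]_(t in `[0, 1]) log_dist a t = ln (cmod a).
Proof.
move=> a1; have a0 : 0 < cmod a := lt_trans ltr01 a1.
have nJ (z : R[i]) : cmod (z^*)%C = cmod z by case: z => x y /=; rewrite sqrrN.
pose b := ((a^*)%C)^-1.
have b1 : cmod b < 1 by rewrite Normc.normcV nJ invf_lt1.
have ab t : log_dist a t = ln (cmod a) + log_dist b t.
  rewrite /log_dist -lnM ?posrE ?expi_dist_gt0 ?(lt_eqF b1)//; congr ln.
  rewrite -[in RHS](nJ a) -Normc.normcM.
  have aJ0 : (a^*)%C != 0.
    by apply/eqP => aJ; move: a0; rewrite -nJ aJ Normc.normc0 ltxx.
  set e := expi _.
  have ee : (e^*)%C * e = 1.
    rewrite /e /expi; apply/eqP; rewrite eq_complex /=; apply/andP; split; apply/eqP.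
      by rewrite -[RHS](cos2Dsin2 (2 * pi * t)); ring.
    by ring.
  have -> : (a^*)%C * (e - b) = - (((e - a)^*)%C * e).
    by rewrite mulrBr divff// rmorphB -ee; ring.
  by rewrite normcN Normc.normcM nJ normc_expi mulr1.
under eq_Rintegral do rewrite ab.
have cb : continuous (log_dist b) by apply: continuous_log_dist; rewrite lt_eqF.
rewrite RintegralD//; last exact: continuous_integrable_itv.
  by rewrite Jensen_inside// addr0 Rintegral_cst_itv// subr0 mulr1.
by apply: (@continuous_integrable_itv _ (fun=> ln (cmod a))) => x; exact: cvg_cst.
Qed.

End Jensen.

(** * The Mahler measure of S0 *)

Section MahlerS0.
Context {R : realType}.
Notation mu := (@lebesgue_measure R).
Implicit Types (t theta u : R).

Definition log_outer theta := ln (outer_modulus (cos theta)).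

Lemma continuous_log_outer : continuous log_outer.
Proof.
move=> theta.
apply: (continuous_comp (f := fun x => outer_modulus (cos x)) (g := @ln R)); last first.
  by apply: continuous_ln; rewrite (lt_le_trans ltr01)// outer_modulus_ge1// cos_le1.
apply: (continuous_comp (f := @cos R) (g := @outer_modulus R)); first exact: continuous_cos.
have csqrt (f : R -> R) : continuous f -> continuous (fun u => Num.sqrt (f u)).
  move=> cf u; apply: (continuous_comp (f := f) (g := Num.sqrt)); first exact: cf.
  exact: sqrt_continuous.
have cadd (f g : R -> R) : continuous f -> continuous g -> continuous (fun u => f u + g u).
  by move=> cf cg u; apply: cvgD; [exact: cf|exact: cg].
have cmul (f g : R -> R) : continuous f -> continuous g -> continuous (fun u => f u * g u).
  by move=> cf cg u; apply: cvgM; [exact: cf|exact: cg].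
have ccst (k : R) : continuous (fun _ : R => k) by move=> u; exact: cvg_cst.
have cX (f : R -> R) n : continuous f -> continuous (fun u => f u ^+ n).
  move=> cf u; apply: (continuous_comp (f := f) (g := fun x : R => x ^+ n)); first exact: cf.
  exact: exprn_continuous.
have cid : continuous (fun u : R => u) by move=> u; exact: cvg_id.
have copp (f : R -> R) : continuous f -> continuous (fun u => - f u).
  by move=> cf u; apply: cvgN; exact: cf.
have cs : continuous (@moduli_sqr_sum R).
  apply: (cmul _ _ (ccst 2)); apply: (cadd _ _ (cX _ 2 cid)); apply: (csqrt _).
  apply: (cadd _ _ _ (ccst 1)); apply: (cadd _ _ (cX _ 4 cid)); apply: copp.
  exact: (cmul _ _ (ccst 2) (cX _ 3 cid)).
apply: (csqrt _); apply: (cmul _ _ _ (ccst 2^-1)); apply: (cadd _ _ cs); apply: (csqrt _).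
exact: (cadd _ _ (cX _ 2 cs) (ccst (- 4))).
Qed.

Lemma cos_eq0_or_1 theta : 0 <= theta <= pi ->
  cos theta = 0 \/ cos theta = 1 <-> theta = 0 \/ theta = pi / 2.
Proof.
have pi0 := pi_gt0 R.
move=> th; split=> [[c|c]|[->|->]]; last 2 first.
- by right; exact: cos0.
- by left; exact: cos_pihalf.
- right; apply: cos_inj; rewrite ?in_itv/= ?th//; last by rewrite c cos_pihalf.
  by apply/andP; split; lra.
- left; apply: cos_inj; rewrite ?in_itv/= ?th ?lexx ?(ltW pi0)//.
  by rewrite c cos0.
Qed.

Lemma modulus_S0_le4 (theta t : R) : cmod (S0 R).[expi theta, expi t] <= 4.
Proof.
rewrite S0E; apply: le_trans (le_normcD _ _) _; rewrite normc_expiX.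
have := le_normcD (expi t ^+ 2) ((expi theta ^+ 2 + 1) * expi t).
rewrite normc_expiX Normc.normcM normc_expi mulr1.
have := le_normcD (expi theta ^+ 2) 1; rewrite normc_expiX Normc.normc1.
by set p := Normc.normc _; set q := Normc.normc _; lra.
Qed.

(** The excluded values of [cos theta] are those for which a root lies on the
    unit circle; elsewhere [S0] does not vanish on the fiber and Jensen's formula
    applies to each of its two linear factors. *)
Lemma integral_log_S0_fiber theta : ~ (cos theta = 0 \/ cos theta = 1) ->
  (\int[mu]_(t in `[0%R, 1%R])
     ((ln 4)%:E - lne (cmod (S0 R).[expi theta, expi (2 * pi * t)])%:E))%E =
  (ln 4 - log_outer theta)%:E.
Proof.
move=> nexc; have [a [b [ab1 ab2 ab]]] := S0_has_roots (expi theta).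
have p : cmod a * cmod b = 1 by rewrite -Normc.normcM ab2 normc_expiX.
have bE := larger_modulusE ab1 ab2 ab.
have an1 : cmod a != 1 by apply/eqP => /(modulus_eq1 ab1 ab2).
have a1 : cmod a < 1.
  rewrite lt_neqAle an1 /= leNgt; apply/negP => a1.
  have := normc_ge0 a; have : 1 < cmod b by exact: lt_le_trans a1 ab.
  by move: p; nra.
have b1 : 1 < cmod b.
  have b0 := normc_ge0 b; rewrite ltNge; apply/negP => b1.
  by have := normc_ge0 a; move: p; nra.
have bn1 : cmod b != 1 by rewrite gt_eqF.
have ca := continuous_log_dist an1; have cb := continuous_log_dist bn1.
pose f t := ln 4 - (log_dist a t + log_dist b t).
have cab : continuous (fun t => log_dist a t + log_dist b t).
  by move=> t; apply: cvgD; [exact: ca|exact: cb].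
have c4 : continuous (fun _ : R => ln 4 : R) by move=> t; exact: cvg_cst.
have cf : continuous f by move=> t; apply: cvgB; [exact: c4|exact: cab].
transitivity (\int[mu]_(t in `[0%R, 1%R]) (f t)%:E)%E.
  apply: eq_integral => t _; rewrite S0E.
  set y := expi (_ * _).
  have -> : y ^+ 2 + (expi theta ^+ 2 + 1) * y + expi theta ^+ 3 = (y - a) * (y - b).
    rewrite -ab2 -[expi theta ^+ 2 + 1]opprK -ab1; ring.
  rewrite Normc.normcM lne_EFin ?mulr_gt0 ?expi_dist_gt0//.
  by rewrite lnM ?posrE ?expi_dist_gt0.
rewrite integral_EFin_continuous// /f; congr (_%:E).
rewrite RintegralB//; [|exact: continuous_integrable_itv..].
rewrite Rintegral_cst_itv// subr0 mulr1 RintegralD//; [|exact: continuous_integrable_itv..].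
by rewrite Jensen_inside// Jensen_outside// add0r bE.
Qed.

(** [log_outer] is even and [2 pi]-periodic, so both halves of the circle
    contribute the same. *)
Lemma integral_log_outer_circle :
  \int[mu]_(t in `[0, 1]) log_outer (2 * pi * t) =
  pi^-1 * \int[mu]_(theta in `[0, pi]) log_outer theta.
Proof.
have pi0 := pi_gt0 R; have cL := continuous_log_outer.
have pi20 : 0 < 2 * pi :> R by rewrite mulr_gt0.
have -> : \int[mu]_(t in `[0, 1]) log_outer (2 * pi * t) =
    (2 * pi)^-1 * \int[mu]_(theta in `[0, 2 * pi]) log_outer theta.
  have := @Rintegral_affine R log_outer 0 1 (2 * pi) 0 cL pi20 ler01.
  rewrite mulr0 mulr1 !addr0 => ->; rewrite mulrA mulVf ?gt_eqF// mul1r.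
  by apply: eq_Rintegral => t _; rewrite addr0.
have pi02 : 0 <= (pi : R) <= 2 * pi by apply/andP; split; lra.
rewrite (Rintegral_itv_split cL pi02).
have -> : \int[mu]_(theta in `[pi, 2 * pi]) log_outer theta =
    \int[mu]_(theta in `[0, pi]) log_outer theta.
  rewrite -Rintegral_even//; last 2 first.
  - exact: ltW.
  - by move=> x; rewrite /log_outer cosN.
  have piN : - pi <= 0 :> R by rewrite oppr_le0 ltW.
  have := @Rintegral_affine R log_outer (- pi) 0 1 (2 * pi) cL ltr01 piN.
  rewrite (_ : 1 * - pi + 2 * pi = pi :> R); last by ring.
  rewrite mulr0 add0r mul1r => ->; apply: eq_Rintegral => x _.
  by rewrite /log_outer mul1r mulr_natl cosD2pi.
set I := Rintegral _ _ _; move: I (lt0r_neq0 pi0) => I.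
by move: (pi : R) => p p0; field.
Qed.

Let measurable_cfun d (T : measurableType d) (h : T -> R[i]) :=
  measurable_fun setT (fun z => complex.Re (h z)) /\
  measurable_fun setT (fun z => complex.Im (h z)).

Lemma measurable_modulus_S0 :
  measurable_fun [set: measurableTypeR R * measurableTypeR R]
    (fun z => cmod (S0 R).[expi (2 * pi * z.1), expi (2 * pi * z.2)]).
Proof.
pose T := (measurableTypeR R * measurableTypeR R)%type.
have mD (h k : T -> R[i]) : measurable_cfun h -> measurable_cfun k ->
    measurable_cfun (fun z => h z + k z).
  move=> [h1 h2] [k1 k2]; split.
    apply: eq_measurable_fun (measurable_funD h1 k1) => z _.
    by rewrite /=; move: (h z) (k z) => [? ?] [? ?].
  apply: eq_measurable_fun (measurable_funD h2 k2) => z _.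
  by rewrite /=; move: (h z) (k z) => [? ?] [? ?].
have mM (h k : T -> R[i]) : measurable_cfun h -> measurable_cfun k ->
    measurable_cfun (fun z => h z * k z).
  move=> [h1 h2] [k1 k2]; split.
    apply: eq_measurable_fun
      (measurable_funB (measurable_funM h1 k1) (measurable_funM h2 k2)) => z _.
    by rewrite /=; move: (h z) (k z) => [? ?] [? ?].
  apply: eq_measurable_fun
    (measurable_funD (measurable_funM h1 k2) (measurable_funM h2 k1)) => z _.
  by rewrite /=; move: (h z) (k z) => [? ?] [? ?].
have m1 : measurable_cfun (fun _ : T => 1) by split; exact: measurable_cst.
have mexpi : measurable_cfun (fun t : measurableTypeR R => expi (2 * pi * t)).
  split; apply: continuous_measurable_fun.
    exact: continuous_comp_cos.
  exact: continuous_comp_sin.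
have mx : measurable_cfun (fun z : T => expi (2 * pi * z.1)).
  case: mexpi => e1 e2; split.
    exact: (measurableT_comp e1 measurable_fst).
  exact: (measurableT_comp e2 measurable_fst).
have my : measurable_cfun (fun z : T => expi (2 * pi * z.2)).
  case: mexpi => e1 e2; split.
    exact: (measurableT_comp e1 measurable_snd).
  exact: (measurableT_comp e2 measurable_snd).
pose x (z : T) : R[i] := expi (2 * pi * z.1).
pose y (z : T) : R[i] := expi (2 * pi * z.2).
pose P z := y z * y z + (x z * x z + 1) * y z + x z * (x z * x z).
have [P1 P2] : measurable_cfun P.
  apply: (mD _ _ (mD _ _ (mM _ _ my my) (mM _ _ _ my)) (mM _ _ mx (mM _ _ mx mx))).
  exact: (mD _ _ (mM _ _ mx mx) m1).
apply: (eq_measurable_fun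
  (fun z => Num.sqrt (complex.Re (P z) ^+ 2 + complex.Im (P z) ^+ 2))).
  by move=> z _; rewrite S0E.
apply: (measurableT_comp (f := @Num.sqrt R)).
  apply: continuous_measurable_fun; exact: sqrt_continuous.
by apply: measurable_funD; apply: measurable_funX.
Qed.

Lemma measurable_lne_EFin : measurable_fun [set: measurableTypeR R] (fun r : R => lne r%:E).
Proof.
apply: measurable_fun_ifT => //.
- by apply: measurable_fun_ler.
- by apply/measurable_EFinP; exact: measurable_ln.
Qed.

Lemma cos_circle_eq0_or_1 (t : R) : 0 <= t <= 1 ->
  cos (2 * pi * t) = 0 \/ cos (2 * pi * t) = 1 ->
  [set 0; 1 / 4; 3 / 4; 1] t.
Proof.
have pi0 := pi_gt0 R; have p0 := lt0r_neq0 pi0.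
have inv (x y : R) : 2 * pi * x = y -> x = y / (2 * pi).
  by move=> <-; rewrite mulrC mulKf// mulf_neq0.
move=> /andP[t0 t1] c; have [th|th] := leP (2 * pi * t) pi.
  have /cos_eq0_or_1[/(_ c)[]/inv ->] : 0 <= 2 * pi * t <= pi.
  - by rewrite th andbT mulr_ge0// mulr_ge0// ltW.
  - by move=> _; left; left; left; rewrite mul0r.
  - by move=> _; left; left; right; move: (pi : R) p0 => p p0; field.
(* on the lower half circle, reflect to 1 - t *)
have c' : cos (2 * pi * (1 - t)) = cos (2 * pi * t).
  by rewrite mulrBr mulr1 -cosN opprB mulr_natl -[LHS]cosD2pi subrK.
have /cos_eq0_or_1[] : 0 <= 2 * pi * (1 - t) <= pi.
  rewrite mulr_ge0 ?subr_ge0//=; last by rewrite mulr_ge0// ltW.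
  by move: th; set w := 2 * pi * t; rewrite mulrBr mulr1 -/w; lra.
rewrite c' => /(_ c)[]/inv e _.
- by right; move: e; rewrite mul0r => /eqP; rewrite subr_eq0 => /eqP ->.
- left; right; rewrite -[t]opprK -[- t](addKr 1) e.
  by move: (pi : R) p0 => p p0 /=; field.
Qed.

(** * Tonelli's theorem for the defect [ln 4 - ln |S0|] *)

Let D : set (measurableTypeR R * measurableTypeR R) := `[0, 1] `*` `[0, 1].

(** Nonnegative since [|S0| <= 4] on the torus, and [+oo] at the zeros. *)
Let defect (z : measurableTypeR R * measurableTypeR R) : \bar R :=
  ((ln 4)%:E - lne (cmod (S0 R).[expi (2 * pi * z.1), expi (2 * pi * z.2)])%:E)%E.

Let measurable_defect : measurable_fun setT defect.
Proof.
apply: emeasurable_funB; first exact: measurable_cst.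
exact: (measurableT_comp measurable_lne_EFin measurable_modulus_S0).
Qed.

Let defect_ge0 z : (0 <= defect z)%E.
Proof.
rewrite /defect; have := modulus_S0_le4 (2 * pi * z.1) (2 * pi * z.2).
set m := Normc.normc _ => m4; have [m0|m0] := leP m 0.
  by rewrite le0_lneNy ?lee_fin//= leey.
by rewrite lne_EFin// -EFinB lee_fin subr_ge0 ler_ln ?posrE.
Qed.

(** The fibers over the finitely many excluded points form a null set, so the
    inner integral is known almost everywhere. *)
Let integral_defect :
  (\int[mu \x mu]_(z in D) defect z)%E =
  (ln 4 - pi^-1 * \int[mu]_(theta in `[0, pi]) log_outer theta)%:E.
Proof.
have mD : measurable D by exact: measurableX.
have mdD : measurable_fun setT (defect \_ D).
  by apply/(measurable_restrictT _ mD); exact: measurable_funTS.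
have dD0 z : (0 <= (defect \_ D) z)%E.
  by rewrite patchE; case: ifP => _; [exact: defect_ge0|exact: lexx].
rewrite integral_mkcond fubini_tonelli1//.
have cL : continuous (fun t => log_outer (2 * pi * t)).
  move=> t; apply: (continuous_comp (f := fun t => 2 * pi * t)).
    by apply: cvgM; [exact: cvg_cst|exact: cvg_id].
  exact: continuous_log_outer.
have c4 : continuous (fun _ : R => ln 4 : R) by move=> t; exact: cvg_cst.
pose G t : R := ln 4 - log_outer (2 * pi * t).
have cG : continuous G by move=> t; apply: cvgB; [exact: c4|exact: cL].
pose G01 : R -> \bar R := (EFin \o G) \_ `[0, 1].
have mG : measurable_fun setT G01.
  apply: (measurable_restrictT (EFin \o G) (measurable_itv `[0, 1])).1.
  apply: measurable_funTS.
  by apply/measurable_EFinP; exact: continuous_measurable_fun.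
transitivity (\int[mu]_t G01 t)%E.
  apply: ae_eq_integral => //.
    exact: measurable_fun_fubini_tonelli_F.
  exists [set 0; 1 / 4; 3 / 4; 1]; split.
  - by do !apply: measurableU; exact: measurable_set1.
  - apply: countable_lebesgue_measure0; apply: finite_set_countable.
    by rewrite !finite_setU; split=> //; split=> //; split.
  - move=> t /= H; apply: contrapT => tN; apply: H => _.
    rewrite /fubini_F /G01 patchE; case: ifPn => [|] tD.
      have t01 : 0 <= t <= 1 by move: tD; rewrite inE /= in_itv.
      apply: (etrans _ (integral_log_S0_fiber (theta := 2 * pi * t) _)); last first.
        by move=> c; apply: tN; exact: cos_circle_eq0_or_1.
      rewrite [RHS]integral_mkcond; apply: eq_integral => y _.
      by rewrite !patchE in_setX tD.
    by rewrite integral0_eq// => y _; rewrite patchE in_setX (negbTE tD).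
rewrite /G01 -integral_mkcond integral_EFin_continuous// /G.
rewrite RintegralB//; [|exact: continuous_integrable_itv..].
by rewrite Rintegral_cst_itv// subr0 mulr1 integral_log_outer_circle.
Qed.

(** [integral_defect] being finite, the defect is integrable, and
    [ln |S0| = ln 4 - defect] also holds where both sides are [-oo]. *)
Lemma mahler_measure_S0 : mahler_measure (fun x y => (S0 R).[x, y]) =
  (pi^-1 * \int[mu]_(theta in `[0, pi]) log_outer theta)%:E.
Proof.
have mD : measurable D by exact: measurableX.
have muD : (mu \x mu)%E D = 1%E.
  rewrite /D product_measure1E//= lebesgue_measure_itv /= lte_fin ltr01.
  by rewrite oppr0 adde0 mule1.
have icst : (mu \x mu)%E.-integrable D (cst (ln 4 : R)%:E).
  apply/integrableP; split; first exact: measurable_cst.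
  by under eq_integral do rewrite /=; rewrite integral_cst//= muD mule1 ltry.
have idef : (mu \x mu)%E.-integrable D defect.
  apply/integrableP; split; first exact: measurable_funTS.
  under eq_integral do rewrite gee0_abs//.
  by rewrite integral_defect ltry.
transitivity (\int[mu \x mu]_(z in D) ((ln 4)%:E - defect z))%E.
  apply: eq_integral => z _; rewrite /defect.
  by case: (lne _) => [r||]//=; rewrite -EFinB; congr (_%:E); ring.
rewrite (integralB mD icst idef) integral_defect integral_cst//= muD mule1.
by rewrite -EFinB; congr (_%:E); ring.
Qed.

End MahlerS0.

Theorem proposition3p1 (R : realType) (ym yp : R[i] -> R[i])
  (* with multiplicity, the two roots of S_0(e^{i theta}, y) in y *)
  (roots_S0 : forall theta : R, 0 <= theta <= pi ->
     (S0 R).[(expi theta)%:P] =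
       ('X - (ym (expi theta))%:P) * ('X - (yp (expi theta))%:P))
  (ym_le_yp : forall theta : R, 0 <= theta <= pi ->
     cmod (ym (expi theta)) <= cmod (yp (expi theta))) :
  let mu := @lebesgue_measure R in
  let I1 := pi^-1 * \int[mu]_(theta in `[0, pi / 2]) ln (cmod (ym (expi theta))) in
  let I2 := pi^-1 * \int[mu]_(theta in `[pi / 2, pi]) ln (cmod (ym (expi theta))) in
  [/\ forall theta : R, 0 <= theta <= pi ->
        cmod (ym (expi theta)) <= 1 <= cmod (yp (expi theta)),
      forall theta : R, 0 <= theta <= pi ->
        (cmod (ym (expi theta)) = 1 <-> theta = 0 \/ theta = pi / 2),
      forall theta : R, 0 <= theta <= pi ->
        cmod (yp (expi theta) * ym (expi theta)) = cmod (expi theta ^+ 3) /\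
        cmod (expi theta ^+ 3) = 1
    & [/\ mahler_measure (fun x y => (S0 R).[x, y]) =
            (pi^-1 * \int[mu]_(theta in `[0, pi]) ln (cmod (yp (expi theta))))%:E,
          pi^-1 * \int[mu]_(theta in `[0, pi]) ln (cmod (yp (expi theta))) =
            - (pi^-1 * \int[mu]_(theta in `[0, pi]) ln (cmod (ym (expi theta))))
        & - (pi^-1 * \int[mu]_(theta in `[0, pi]) ln (cmod (ym (expi theta)))) =
            - (I1 + I2)]].
Proof.
move=> mu I1 I2.
have vieta theta : 0 <= theta <= pi ->
    ym (expi theta) + yp (expi theta) = - (expi theta ^+ 2 + 1) /\
    ym (expi theta) * yp (expi theta) = expi theta ^+ 3.
  by move=> /roots_S0 /Vieta_S0.
have ypE theta : 0 <= theta <= pi ->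
    cmod (yp (expi theta)) = outer_modulus (cos theta).
  by move=> th; have [e1 e2] := vieta _ th; exact: larger_modulusE e1 e2 (ym_le_yp _ th).
have prod1 theta : 0 <= theta <= pi -> cmod (ym (expi theta)) * cmod (yp (expi theta)) = 1.
  by move=> /vieta[_ e2]; rewrite -Normc.normcM e2 normc_expiX.
have yp1 theta : 0 <= theta <= pi -> 1 <= cmod (yp (expi theta)).
  by move=> th; rewrite ypE// outer_modulus_ge1// cos_le1.
have ymE theta : 0 <= theta <= pi -> cmod (ym (expi theta)) = (outer_modulus (cos theta))^-1.
  move=> th; rewrite -ypE//; have y0 := lt_le_trans ltr01 (yp1 _ th).
  by apply: (mulIf (lt0r_neq0 y0)); rewrite prod1// mulVf ?lt0r_neq0.
have cL := @continuous_log_outer R.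
have cNL : continuous (fun t : R => - log_outer t) by move=> t; apply: cvgN; exact: cL.
have pi0 := pi_gt0 R.
have int_yp : \int[mu]_(theta in `[0, pi]) ln (cmod (yp (expi theta))) =
    \int[mu]_(theta in `[0, pi]) log_outer theta.
  by apply: eq_Rintegral => th; rewrite inE /= in_itv /= => th0; rewrite ypE.
have int_ym (a b : R) : 0 <= a -> b <= pi ->
    \int[mu]_(theta in `[a, b]) ln (cmod (ym (expi theta))) =
    \int[mu]_(theta in `[a, b]) - log_outer theta.
  move=> a0 bpi; apply: eq_Rintegral => th; rewrite inE /= in_itv /= => /andP[ath thb].
  have th0 : 0 <= th <= pi by rewrite (le_trans a0 ath) (le_trans thb bpi).
  by rewrite ymE// lnV// posrE -ypE// (lt_le_trans ltr01)// yp1.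
split.
- move=> th th0; rewrite yp1// andbT ymE// invf_le1 ?outer_modulus_ge1 ?cos_le1//.
  by rewrite (lt_le_trans ltr01)// outer_modulus_ge1// cos_le1.
- move=> th th0; have [e1 e2] := vieta _ th0.
  by rewrite (modulus_eq1 e1 e2); exact: cos_eq0_or_1.
- move=> th th0; rewrite normc_expiX Normc.normcM mulrC.
  by rewrite prod1.
- split.
  + by rewrite mahler_measure_S0 int_yp.
  + rewrite int_ym// int_yp -mulrN; congr (_ * _).
    rewrite -[RHS]mulN1r -RintegralZl//; last exact: (continuous_integrable_itv _ _ cNL).
    by apply: eq_Rintegral => th _; rewrite mulN1r opprK.
  + rewrite /I1 /I2 !int_ym//; [|lra..].
    rewrite -mulrDr -Rintegral_itv_split//.
    by apply/andP; split; lra.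
Qed.
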